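(* Let $A$ be a PS domain. Then any free $A$-module is a PS module over $A$.
   Context: All rings are commutative and unitary. For an integral domain $A$, a torsion-free $A$-module $M$ is a PS module (pre-Schreier module) if every equality $ax=by$ with $a,b\in A-\{0\}$ and $x,y\in M-\{0\}$ has a refinement, i.e. there exist $c,d,e\in A$ and $z\in M$ with $a=ce$, $b=cd$, $x=dz$, $y=ez$. $A$ is a PS domain (pre-Schreier domain) if it is a PS module over itself. *)

(* Defs.v *)
From HB Require Import structures.
From mathcomp Require Import all_boot all_order all_algebra.

Set Implicit Arguments.
Unset Strict Implicit.
Unset Printing Implicit Defensive.

Import GRing.Theory.
Local Open Scope ring_scope.

Definition torsion_free (A : idomainType) (M : lmodType A) : Prop :=
  forall (a : A) (x : M), a *: x = 0 -> a = 0 \/ x = 0.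

Definition PS_module (A : idomainType) (M : lmodType A) : Prop :=
  torsion_free M /\
  forall (a b : A) (x y : M),
    a != 0 -> b != 0 -> x != 0 -> y != 0 -> a *: x = b *: y ->
    exists (c d e : A) (z : M),
      [/\ a = c * e, b = c * d, x = d *: z & y = e *: z].

Definition PS_domain (A : idomainType) : Prop := PS_module A^o.

(* Bases are arbitrary, possibly infinite, subsets B of M; finite linear
   combinations are indexed by finite sequences of elements of B. *)
Definition lin_indep (A : idomainType) (M : lmodType A) (B : M -> Prop) : Prop :=
  forall (s : seq M) (c : M -> A),
    uniq s -> {in s, forall u, B u} -> \sum_(u <- s) c u *: u = 0 ->
    {in s, forall u, c u = 0}.

Definition spans (A : idomainType) (M : lmodType A) (B : M -> Prop) : Prop :=
  forall x : M, exists (s : seq M) (c : M -> A),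
    {in s, forall u, B u} /\ x = \sum_(u <- s) c u *: u.

Definition free_module (A : idomainType) (M : lmodType A) : Prop :=
  exists B : M -> Prop, lin_indep B /\ spans B.

(* Main.v *)
(** In coordinates over a basis, [a *: x = b *: y] becomes a finite family of
    equalities [a * x_i = b * y_i] in [A], and one needs a single [c, d, e]
    refining all of them.  This goes by induction on the family: once
    [a = c * e] and [b = c * d] refine the first equalities, cancelling [c] in
    the next one leaves [e * x = d * y]; refining this as [e = c' * e'],
    [d = c' * d'] and replacing [(c, d, e)] by [(c * c', d', e')] handles the
    new equality and multiplies the earlier quotients by [c']. *)
Require Import Defs.
From HB Require Import structures.
From mathcomp Require Import all_boot all_order all_algebra.

Set Implicit Arguments.
Unset Strict Implicit.
Unset Printing Implicit Defensive.

Import GRing.Theory.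
Local Open Scope ring_scope.

(** Coordinates of a nonzero vector may vanish, so the refinement property is needed for zero [x] or
    [y] too. As [a] and [b] are nonzero, [x] and [y] vanish together, and [z = 0] then works with
    [c = 1]. *)
Lemma PS_domain_refine (A : idomainType) (a b x y : A) :
  PS_domain A -> a != 0 -> b != 0 -> a * x = b * y ->
  exists c d e z, [/\ a = c * e, b = c * d, x = d * z & y = e * z].
Proof.
move=> [_ hA] a0 b0 eq_axby.
have [x0|x0] := eqVneq x 0.
  exists 1, b, a, 0; rewrite !mul1r !mulr0; split=> //.
  by apply: (mulfI b0); rewrite -eq_axby x0 !mulr0.
apply: (hA a b x y) => //; apply: contra_neq x0 => y0.
by apply: (mulfI a0); rewrite eq_axby y0 !mulr0.
Qed.

Lemma PS_domain_refine_seq (A : idomainType) (I : eqType) (a b : A)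
    (x y : I -> A) (t : seq I) :
  PS_domain A -> a != 0 -> b != 0 -> {in t, forall i, a * x i = b * y i} ->
  exists c d e z, [/\ a = c * e, b = c * d &
    {in t, forall i, x i = d * z i /\ y i = e * z i}].
Proof.
move=> hA a0 b0; elim: t => [_|j t IHt eq_axby].
  by exists 1, b, a, (fun=> 0); rewrite !mul1r.
have [|c [d [e [z [def_a def_b def_xy]]]]] := IHt.
  by move=> i ti; apply: eq_axby; rewrite inE ti orbT.
have [c0 e0] : c != 0 /\ e != 0.
  by apply/andP; rewrite -negb_or -mulf_eq0 -def_a.
have d0 : d != 0 by apply: contraNneq b0 => d0; rewrite def_b d0 mulr0.
have eq_exdy : e * x j = d * y j.
  by apply: (mulfI c0); rewrite !mulrA -def_a -def_b eq_axby ?mem_head.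
have [c' [d' [e' [w [def_e def_d def_x def_y]]]]] :=
  PS_domain_refine hA e0 d0 eq_exdy.
(* The value at [j] is [w] even if [j] recurs in [t]; at any other index the factor [c'] of [d] and
   [e] passes to [z i]. *)
exists (c * c'), d', e', (fun i => if i == j then w else c' * z i).
rewrite -!mulrA -def_e -def_d; split=> // i; rewrite inE.
have [-> //|_ /= /def_xy[-> ->]] := eqVneq i j.
by rewrite !mulrA ![_ * c']mulrC -def_e -def_d.
Qed.

(** Spanning sequences may repeat vectors, whereas [lin_indep] needs distinct ones: multiplicities
    are absorbed into the coefficients, which become zero off [s]. *)
Lemma sum_scale_count (A : idomainType) (M : lmodType A) (c : M -> A)
    (s t : seq M) :
  uniq t -> {subset s <= t} ->
  \sum_(u <- s) c u *: u = \sum_(u <- t) (c u *+ count_mem u s) *: u.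
Proof.
move=> Ut; elim: s => [_|v s IHs sub_t].
  by rewrite big_nil big1 // => u _; rewrite mulr0n scale0r.
rewrite big_cons IHs => [|u su]; last by apply: sub_t; rewrite inE su orbT.
under [RHS]eq_bigr do rewrite /= mulrnDr scalerDl.
rewrite big_split /=; congr (_ + _).
rewrite (bigD1_seq v) ?sub_t ?mem_head //= eqxx big1 ?addr0 // => u.
by rewrite eq_sym => /negPf->; rewrite scale0r.
Qed.

(** Leaving [t] free lets two vectors be expanded over one common sequence. *)
Lemma spans_coord (A : idomainType) (M : lmodType A) (B : M -> Prop) (x : M) :
  spans B -> exists (s : seq M) (c : M -> A), {in s, forall u, B u} /\
    forall t, uniq t -> {subset s <= t} -> x = \sum_(u <- t) c u *: u.
Proof.
move=> /(_ x)[s [c [sB ->]]]; exists s, (fun u => c u *+ count_mem u s).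
by split=> // t; apply: sum_scale_count.
Qed.

Lemma free_module_torsion_free (A : idomainType) (M : lmodType A) :
  free_module M -> torsion_free M.
Proof.
move=> [B [indB spanB]] a x ax0.
have [->|a0] := eqVneq a 0; [by left | right].
have [s [c [sB /(_ (undup s) (undup_uniq s))def_x]]] := spans_coord x spanB.
have {}def_x : x = \sum_(u <- undup s) c u *: u.
  by apply: def_x => u; rewrite mem_undup.
rewrite def_x big_seq big1 // => u su.
have /eqP : a * c u = 0.
  apply: (indB (undup s) (fun v => a * c v)) => //; first exact: undup_uniq.
    by move=> v; rewrite mem_undup => /sB.
  by under eq_bigr do rewrite -scalerA; rewrite -scaler_sumr -def_x.
by rewrite mulf_eq0 (negPf a0) => /eqP->; rewrite scale0r.
Qed.

Theorem corollary4p3 (A : idomainType) (hA : PS_domain A)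
  (M : lmodType A) (hM : free_module M) : PS_module M.
Proof.
split=> [|a b x y a0 b0 _ _ eq_axby]; first exact: free_module_torsion_free.
have [B [indB spanB]] := hM.
have [s [xc [sB def_x]]] := spans_coord x spanB.
have [r [yc [rB def_y]]] := spans_coord y spanB.
pose t := undup (s ++ r).
have Ut : uniq t by apply: undup_uniq.
have {}def_x : x = \sum_(u <- t) xc u *: u.
  by apply: def_x => // u su; rewrite mem_undup mem_cat su.
have {}def_y : y = \sum_(u <- t) yc u *: u.
  by apply: def_y => // u ru; rewrite mem_undup mem_cat ru orbT.
have tB : {in t, forall u, B u}.
  by move=> u; rewrite mem_undup mem_cat => /orP[/sB|/rB].
have eq_coord : {in t, forall u, a * xc u = b * yc u}.
  move=> u tu; apply/eqP; rewrite -subr_eq0; apply/eqP.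
  (* Independence is applied to the expansion of [a *: x - b *: y = 0]. *)
  apply: (indB t (fun v => a * xc v - b * yc v)) => //.
  under eq_bigr do rewrite scalerBl -!scalerA.
  by rewrite sumrB -!scaler_sumr -def_x -def_y eq_axby subrr.
have [c [d [e [z [def_a def_b def_xy]]]]] :=
  PS_domain_refine_seq hA a0 b0 eq_coord.
exists c, d, e, (\sum_(u <- t) z u *: u); split=> //.
  rewrite def_x scaler_sumr; apply: eq_big_seq => u /def_xy[-> _].
  by rewrite scalerA.
rewrite def_y scaler_sumr; apply: eq_big_seq => u /def_xy[_ ->].
by rewrite scalerA.
Qed.
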